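(* A rational transduction $f$ is aperiodic (i.e. $\mathcal{A}p$-rational) if and only if its canonical bimachine $\mathcal B_f$ is aperiodic, i.e. both $\mathit{Left}_f(\mathcal R_f)$ and $\mathcal R_f$ have aperiodic transition congruences.
   Context: A congruence $\sim$ on $\Sigma^*$ is aperiodic if there is $n$ with $w^n\sim w^{n+1}$ for all $w$. For an automaton $\mathcal A=(Q,\Delta,I,F)$ (left or right), $u\approx_{\mathcal A}v$ iff for all $p,q$ there is a run on $u$ from $p$ to $q$ iff on $v$; $\mathcal A$ is aperiodic if $\approx_{\mathcal A}$ is aperiodic. A transduction is $\mathcal{A}p$-rational if realized by a functional transducer (automaton with outputs on transitions, initial and final outputs) with aperiodic underlying automaton. Notation: $u^{-1}v$ is the $v'$ with $uv'=v$; $\bigwedge L$ is the longest common prefix ($\bigwedge\emptyset=\varepsilon$); $d(u,v)=|u|+|v|-2|u\wedge v|$. Define $u\leftharpoonup_fv$ iff for all $w$, $wu\in\mathrm{dom}f\Leftrightarrow wv\in\mathrm{dom}f$ and $\sup\{d(f(wu),f(wv)):wu\in\mathrm{dom}f\}<\infty$. $\mathcal R_f$ is the right automaton (backward deterministic, read right to left) with states $\Sigma^*/{\leftharpoonup_f}$, transitions $([\sigma w],\sigma,[w])$, initial $[\varepsilon]$, finals $\{[w]:w\in\mathrm{dom}f\}$; write $[w]_{\mathcal R_f}$ for the class. Let $\widehat f_{[w]}(u)=\bigwedge\{f(uv):v\leftharpoonup_fw,uv\in\mathrm{dom}f\}$ and $u\sim_Lv$ iff for all $w$, $uw\in\mathrm{dom}f\Leftrightarrow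 vw\in\mathrm{dom}f$ and (if so) $\widehat f_{[w]}(u)^{-1}f(uw)=\widehat f_{[w]}(v)^{-1}f(vw)$. $\mathit{Left}_f(\mathcal R_f)$ is the deterministic automaton on $\Sigma^*/{\sim_L}$ with transitions $([u],\sigma,[u\sigma])$, initial $[\varepsilon]$, finals $\{[u]:u\in\mathrm{dom}f\}$. The canonical bimachine is $\mathcal B_f=(\mathit{Left}_f(\mathcal R_f),\mathcal R_f,\omega_f,\lambda_f,\rho_f)$ with $\omega_f([u]_L,\sigma,[w])=\widehat f_{[\sigma w]}(u)^{-1}\widehat f_{[w]}(u\sigma)$, $\lambda_f([w])=\widehat f_{[w]}(\varepsilon)$, $\rho_f([u]_L)=\widehat f_{[\varepsilon]}(u)^{-1}f(u)$; it realizes $f$. *)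

(* Defs.v *)
From mathcomp Require Import all_boot.
From Stdlib Require Import ClassicalEpsilon.
Set Implicit Arguments.
Unset Strict Implicit.
Unset Printing Implicit Defensive.

Section Words.
Variable Γ : eqType.

Fixpoint lcp (u v : seq Γ) : seq Γ :=
  match u, v with
  | a :: u', b :: v' => if a == b then a :: lcp u' v' else [::]
  | _, _ => [::]
  end.

Definition wdist (u v : seq Γ) : nat := size u + size v - 2 * size (lcp u v).

(* u^{-1} v : the v' with u v' = v (meaningful when u is a prefix of v) *)
Definition lquot (u v : seq Γ) : seq Γ := drop (size u) v.

(* x is the longest common prefix of the (possibly infinite) language L,
   with the convention  /\ emptyset = epsilon *)
Definition is_bigwedge (L : seq Γ -> Prop) (x : seq Γ) : Prop :=
  ((forall y, ~ L y) -> x = [::]) /\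
  ((exists y, L y) ->
     (forall y, L y -> prefix x y) /\
     (forall z, (forall y, L y -> prefix z y) -> prefix z x)).

Definition bigwedge (L : seq Γ -> Prop) : seq Γ :=
  epsilon (inhabits [::]) (is_bigwedge L).

Definition wpow (T : Type) (w : seq T) (n : nat) : seq T := flatten (nseq n w).
End Words.

Record automaton (Σ : Type) := Automaton {
  st : Type;
  tr : st -> Σ -> st -> Prop;
  ini : st -> Prop;
  fin : st -> Prop }.

Inductive reach {Σ : Type} (A : automaton Σ) : st A -> seq Σ -> st A -> Prop :=
| reach_nil p : reach p [::] p
| reach_cons p a q u r : tr p a q -> reach q u r -> reach p (a :: u) r.
Arguments reach {Σ} A _ _ _.

Definition aut_equiv (Σ : Type) (A : automaton Σ) (u v : seq Σ) : Prop :=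
  forall p q : st A, reach A p u q <-> reach A p v q.

Definition aperiodic_cong (Σ : Type) (R : seq Σ -> seq Σ -> Prop) : Prop :=
  exists n, forall w, R (wpow w n) (wpow w n.+1).

Definition aperiodic_aut (Σ : Type) (A : automaton Σ) : Prop :=
  aperiodic_cong (aut_equiv A).

Record transducer (Σ Γ : Type) := Transducer {
  tQ : finType;
  tdelta : tQ -> Σ -> tQ -> bool;
  tout : tQ -> Σ -> tQ -> seq Γ;
  tinit : tQ -> option (seq Γ);             (* initial states with initial output *)
  tfinal : tQ -> option (seq Γ) }.          (* final states with final output *)

Inductive trun (Σ Γ : Type) (T : transducer Σ Γ) :
  tQ T -> seq Σ -> tQ T -> seq Γ -> Prop :=
| trun_nil p : trun p [::] p [::]
| trun_cons p a q u r x :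
    tdelta p a q -> trun q u r x -> trun p (a :: u) r (tout p a q ++ x).
Arguments trun {Σ Γ} T _ _ _ _.

(* T realizes the (partial) function f; in particular T is functional *)
Definition realizes (Σ Γ : Type) (T : transducer Σ Γ)
  (f : seq Σ -> option (seq Γ)) : Prop :=
  forall u y, f u = Some y <->
    exists (p q : tQ T) i o x, tinit p = Some i /\ tfinal q = Some o /\
                      trun T p u q x /\ y = i ++ x ++ o.

Definition underlying (Σ Γ : Type) (T : transducer Σ Γ) : automaton Σ :=
  @Automaton Σ (tQ T) (fun p a q => tdelta p a q)
    (fun p => tinit p <> None) (fun q => tfinal q <> None).

Definition rational (Σ Γ : Type) (f : seq Σ -> option (seq Γ)) : Prop :=
  exists T : transducer Σ Γ, realizes T f.

Definition ap_rational (Σ Γ : Type) (f : seq Σ -> option (seq Γ)) : Prop :=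
  exists T : transducer Σ Γ, realizes T f /\ aperiodic_aut (underlying T).

Section Canonical.
Variables (Σ : Type) (Γ : eqType) (f : seq Σ -> option (seq Γ)).

Definition indom (u : seq Σ) : Prop := f u <> None.

Definition lharp (u v : seq Σ) : Prop :=
  (forall w, indom (w ++ u) <-> indom (w ++ v)) /\
  exists B, forall w x y, f (w ++ u) = Some x -> f (w ++ v) = Some y ->
                          wdist x y <= B.

(* states of a quotient automaton: equivalence classes, as predicates *)
Definition qstate (E : seq Σ -> seq Σ -> Prop) : Type :=
  {P : seq Σ -> Prop | exists w, P = E w}.

Definition Rf : automaton Σ :=
  @Automaton Σ (qstate lharp)
    (fun p a q => exists w, proj1_sig p = lharp (a :: w) /\ proj1_sig q = lharp w)
    (fun p => proj1_sig p = lharp [::])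
    (fun p => exists w, proj1_sig p = lharp w /\ indom w).

Definition fhat (w u : seq Σ) : seq Γ :=
  bigwedge (fun x => exists v, lharp v w /\ f (u ++ v) = Some x).

Definition simL (u v : seq Σ) : Prop :=
  forall w, (indom (u ++ w) <-> indom (v ++ w)) /\
    (forall x y, f (u ++ w) = Some x -> f (v ++ w) = Some y ->
       lquot (fhat w u) x = lquot (fhat w v) y).

Definition Leftf : automaton Σ :=
  @Automaton Σ (qstate simL)
    (fun p a q => exists u, proj1_sig p = simL u /\ proj1_sig q = simL (rcons u a))
    (fun p => proj1_sig p = simL [::])
    (fun p => exists u, proj1_sig p = simL u /\ indom u).

Definition canonical_bimachine_aperiodic : Prop :=
  aperiodic_aut Leftf /\ aperiodic_aut Rf.
End Canonical.

(* Main.v *)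
Require Import Defs.
From mathcomp Require Import all_boot.
From mathcomp Require Import boolp zify.

(** A functional transducer [T] realizing [f] determines [lharp]: two words that
    are accepted from the same states of [T] are [lharp]-related, because the
    outputs produced before reaching them coincide.  Hence [Rf] is finite, and
    aperiodic if [T] is.

    If [T] is aperiodic, a long run on [u^N] visits a state [r] that loops on [u^c]
    for every large [c].  By functionality the outputs [g c] of these loops satisfy
    [g (c + d) = g c ++ g d], so that [f (t u^(N0+m) w) = A B^m C] with [N0]
    depending on [T] only.  If [v] is [lharp]-related to [w], the words
    [f (t u^(N0+m) w)] and [f (t u^(N0+m) v)] stay at bounded distance; then their
    periods are conjugate, and what remains of the former after their longest common
    prefix does not depend on [m].  Since [fhat] is such a longest common prefix,
    for a [v] minimizing its length, [t u^N0] and [t u^(N0+1)] are [simL]-related.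

    Conversely, the canonical bimachine is simulated by the transducer whose states
    are the pairs of a left class and a guessed right class; a word acts on it as it
    does on [Leftf f] and [Rf f].  Its finiteness requires that of [simL]: the
    class of [u] is determined by the delays between [fhat f w u] and the outputs
    of [T] on [u], and these delays are bounded uniformly in [u] and [w]. *)

Set Implicit Arguments.
Unset Strict Implicit.
Unset Printing Implicit Defensive.

Lemma exists_minimizer (T : Type) (P : T -> Prop) (m : T -> nat) :
  (exists x, P x) -> exists2 x, P x & forall y, P y -> m x <= m y.
Proof.
case=> x Px; have [k] := ubnP (m x); elim: k x Px => // k IHk x Px lt_mk.
have [[y [Py lt_yx]]|min_x] := EM (exists y, P y /\ m y < m x).
  by apply: (IHk y) => //; apply: leq_trans lt_yx _.
by exists x => // y Py; rewrite leqNgt; apply/negP => lt_yx; apply: min_x; exists y.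
Qed.

(** Used with states, or pairs of states, as [X]: bounds found separately for each of them are
    merged into one constant. *)
Lemma uniform_bound (X : finType) (P : X -> nat -> Prop) :
  (forall x m n, m <= n -> P x m -> P x n) ->
  (forall x, exists n, P x n) -> exists n, forall x, P x n.
Proof.
move=> Pmono /choice[b Pb]; exists (\max_x b x) => x.
by apply: Pmono (Pb x); apply: leq_bigmax.
Qed.

(** * Longest common prefixes, the prefix distance, and periods of words *)

Section WordCombinatorics.
Variable Γ : eqType.
Implicit Types u v w x y z : seq Γ.

Lemma lcpC u v : lcp u v = lcp v u.
Proof.
elim: u v => [|a u IHu] [|b v] //=; rewrite eq_sym.
by case: eqP => // ->; rewrite IHu.
Qed.

Lemma lcp_prefixl u v : prefix (lcp u v) u.
Proof.
by elim: u v => [|a u IHu] [|b v] //=; case: eqP => //= _; rewrite eqxx IHu.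
Qed.

Lemma lcp_prefixr u v : prefix (lcp u v) v.
Proof. by rewrite lcpC lcp_prefixl. Qed.

Lemma prefix_lcp z u v : prefix z (lcp u v) = prefix z u && prefix z v.
Proof.
apply/idP/andP => [pz|[]].
  by split; apply: (prefix_trans pz); rewrite ?lcp_prefixl ?lcp_prefixr.
elim: z u v => [|c z IHz] [|a u] [|b v] //=; rewrite ?prefix0s //.
by case/andP=> /eqP <- zu /andP[/eqP <- zv]; rewrite eqxx /= eqxx IHz.
Qed.

Lemma lcp_cat x u v : lcp (x ++ u) (x ++ v) = x ++ lcp u v.
Proof. by elim: x => //= a x ->; rewrite eqxx. Qed.

Lemma size_lcpl u v : size (lcp u v) <= size u.
Proof. exact: size_prefix (lcp_prefixl u v). Qed.

Lemma size_lcpr u v : size (lcp u v) <= size v.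
Proof. exact: size_prefix (lcp_prefixr u v). Qed.

Lemma prefix_anti u v : prefix u v -> prefix v u -> u = v.
Proof.
move=> /prefixP[s ->] /size_prefix; rewrite size_cat.
by case: s => [|a s] /=; rewrite ?cats0 //; lia.
Qed.

Lemma prefix_comparable u v w :
  prefix u w -> prefix v w -> size u <= size v -> prefix u v.
Proof.
case/prefixP=> s def_w; rewrite def_w => /prefixP[t def_t] le_uv; rewrite prefixE.
by rewrite -(takel_cat t le_uv) -def_t take_size_cat.
Qed.

Lemma cat_lquot u v : prefix u v -> u ++ lquot u v = v.
Proof. by case/prefixP=> s ->; rewrite /lquot drop_size_cat. Qed.

Lemma lquot_cat u v : lquot u (u ++ v) = v.
Proof. by rewrite /lquot drop_size_cat. Qed.

Lemma lquot_catC u v x : lquot (x ++ u) (x ++ v) = lquot u v.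
Proof. by rewrite /lquot size_cat drop_cat ltnNge leq_addr addKn. Qed.

Lemma cat_injl x u v : x ++ u = x ++ v -> u = v.
Proof. by move/(congr1 (lquot x)); rewrite !lquot_cat. Qed.

Lemma wdistC u v : wdist u v = wdist v u.
Proof. by rewrite /wdist lcpC addnC. Qed.

(** Both [lcp u v] and [lcp v w] are prefixes of [v], hence comparable; the shorter one is a common
    prefix of [u] and [w]. *)
Lemma wdist_triangle u v w : wdist u w <= wdist u v + wdist v w.
Proof.
have : minn (size (lcp u v)) (size (lcp v w)) <= size (lcp u w).
  have [le|lt] := leqP (size (lcp u v)) (size (lcp v w)).
    apply: size_prefix; rewrite prefix_lcp lcp_prefixl /=.
    apply: prefix_trans (lcp_prefixr v w).
    exact: prefix_comparable (lcp_prefixr _ _) (lcp_prefixl _ _) le.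
  apply: size_prefix; rewrite prefix_lcp lcp_prefixr andbT.
  apply: prefix_trans (lcp_prefixl u v).
  by apply: prefix_comparable (lcp_prefixl _ _) (lcp_prefixr _ _) (ltnW lt).
have := size_lcpl u v; have := size_lcpr u v; have := size_lcpl v w.
by have := size_lcpr v w; have := size_lcpl u w; have := size_lcpr u w; rewrite /wdist; lia.
Qed.

Lemma wdist_cat x u v : wdist (x ++ u) (x ++ v) <= size u + size v.
Proof. by rewrite /wdist lcp_cat !size_cat; lia. Qed.

Lemma wpowD (T : Type) (w : seq T) m n : wpow w (m + n) = wpow w m ++ wpow w n.
Proof. by rewrite /wpow nseqD flatten_cat. Qed.

Lemma wpow1 (T : Type) (w : seq T) : wpow w 1 = w.
Proof. exact: cats0. Qed.

Lemma wpowSr (T : Type) (w : seq T) n : wpow w n.+1 = wpow w n ++ w.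
Proof. by rewrite -addn1 wpowD wpow1. Qed.

Lemma wpow_nil (T : Type) n : wpow [::] n = [::] :> seq T.
Proof. by elim: n. Qed.

Lemma wpow_mul (T : Type) (w : seq T) m n : wpow (wpow w m) n = wpow w (n * m).
Proof. by elim: n => //= n IHn; rewrite mulSn wpowD -IHn. Qed.

Lemma size_wpow (T : Type) (w : seq T) n : size (wpow w n) = n * size w.
Proof. by elim: n => //= n IHn; rewrite size_cat -/(wpow w n) IHn mulSn. Qed.

Lemma wpow_conj (x u v : seq Γ) n :
  x ++ v = u ++ x -> x ++ wpow v n = wpow u n ++ x.
Proof.
move=> xv; elim: n => [|n IHn]; first by rewrite cats0.
by rewrite wpowSr catA IHn -catA xv catA -wpowSr.
Qed.

Lemma is_bigwedge_uniq (L : seq Γ -> Prop) x y :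
  is_bigwedge L x -> is_bigwedge L y -> x = y.
Proof.
case=> x0 xP [y0 yP]; have [ne|em] := EM (exists z, L z).
  have [[xL xm] [yL ym]] := (xP ne, yP ne).
  by apply: prefix_anti; [apply: ym | apply: xm].
by rewrite x0 ?y0 // => z Lz; apply: em; exists z.
Qed.

(** The words [lcp y0 y] are all prefixes of [y0], so the shortest of them is a prefix of the others
    and of every member of [L]. Thus a longest common prefix is always reached by two members. *)
Lemma is_bigwedge_lcp (L : seq Γ -> Prop) y0 y1 : L y0 -> L y1 ->
    (forall y, L y -> size (lcp y0 y1) <= size (lcp y0 y)) ->
  is_bigwedge L (lcp y0 y1).
Proof.
move=> L0 L1 min1; split=> [/(_ y0)//|_]; split=> [y Ly|z zL].
  apply: prefix_trans (lcp_prefixr y0 y).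
  exact: prefix_comparable (lcp_prefixl _ _) (lcp_prefixl _ _) (min1 y Ly).
by rewrite prefix_lcp !zL.
Qed.

Lemma bigwedgeP (L : seq Γ -> Prop) : is_bigwedge L (bigwedge L).
Proof.
apply: ClassicalEpsilon.epsilon_spec.
have [[y0 L0]|em] := EM (exists z, L z); last first.
  by exists [::]; split=> // /em.
have [y1 L1 min1] := exists_minimizer (fun y => size (lcp y0 y)) (ex_intro _ y0 L0).
by exists (lcp y0 y1); apply: is_bigwedge_lcp.
Qed.

Lemma bigwedge_lcp (L : seq Γ -> Prop) y0 y1 : L y0 -> L y1 ->
    (forall y, L y -> size (lcp y0 y1) <= size (lcp y0 y)) ->
  bigwedge L = lcp y0 y1.
Proof.
by move=> L0 L1 m; apply: is_bigwedge_uniq (bigwedgeP L) (is_bigwedge_lcp L0 L1 m).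
Qed.

Lemma bigwedge_prefix (L : seq Γ -> Prop) y : L y -> prefix (bigwedge L) y.
Proof. by move=> Ly; case: (bigwedgeP L) => _ [|h _]; [exists y | apply: h]. Qed.

Lemma prefix_bigwedge (L : seq Γ -> Prop) z :
  (exists y, L y) -> (forall y, L y -> prefix z y) -> prefix z (bigwedge L).
Proof. by move=> ne zL; case: (bigwedgeP L) => _ /(_ ne)[_]; apply. Qed.

Lemma bigwedge_empty (L : seq Γ -> Prop) : ~ (exists y, L y) -> bigwedge L = [::].
Proof. by move=> em; case: (bigwedgeP L) => h _; apply: h => y Ly; apply: em; exists y. Qed.

Lemma bigwedge_cat (L : seq Γ -> Prop) p : (exists y, L y) ->
    (forall y, L y -> prefix p y) ->
  bigwedge L = p ++ bigwedge (fun z => L (p ++ z)).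
Proof.
move=> ne pL; apply: prefix_anti; last first.
  apply: prefix_bigwedge => // y Ly; have /prefixP[z def_y] := pL y Ly.
  rewrite def_y prefix_catr // eqxx /=; apply: bigwedge_prefix.
  by rewrite -def_y.
have /prefixP[X defX] := prefix_bigwedge ne pL.
rewrite defX prefix_catr // eqxx /=; apply: prefix_bigwedge => [|z Lz].
  have [y Ly] := ne; have /prefixP[z def_y] := pL y Ly.
  by exists z; rewrite -def_y.
by have := bigwedge_prefix Lz; rewrite defX prefix_catr // eqxx.
Qed.

Lemma prefix_size_eq u v w :
  prefix u w -> prefix v w -> size u = size v -> u = v.
Proof.
move=> uw vw eq_uv.
by apply: prefix_anti;
   [apply: (prefix_comparable uw vw) | apply: (prefix_comparable vw uw)]; rewrite eq_uv.
Qed.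

(** The word [E] is what [A'] reads beyond [A], a prefix of a power of [B]. The prefix of [X] of
    length [size A' + size B'] is then both [A E B'] and [A B E]. *)
Lemma pumped_conj (A B C A' B' C' : seq Γ) k :
    let X := A ++ wpow B k.+1 ++ C in let Y := A' ++ wpow B' k.+1 ++ C' in
    size A <= size A' -> size B = size B' -> size A' <= k * size B ->
    size A' + size B' <= size (lcp X Y) ->
  exists2 E, A' = A ++ E & E ++ B' = B ++ E.
Proof.
move=> X Y leA eqB leA' le_lcp.
have AX : prefix A X by apply: prefix_prefix.
have A'BX : prefix (A' ++ B') X.
  apply: prefix_trans (lcp_prefixl X Y); apply: prefix_comparable (lcp_prefixr X Y) _.
    by rewrite /Y /= -!catA catA prefix_prefix.
  by rewrite size_cat.
have A'X : prefix A' X by apply: catl_prefix A'BX.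
have /prefixP[E defA'] := prefix_comparable AX A'X leA.
exists E => //; apply: (@cat_injl A); rewrite catA -defA'.
apply: (@prefix_size_eq _ _ X) => //; last by rewrite defA' !size_cat eqB; lia.
rewrite /X prefix_catr // eqxx /= -catA prefix_catr // eqxx /=.
apply: prefix_catl; have : prefix (A ++ E) (A ++ wpow B k).
  apply: (@prefix_comparable _ _ X); first by rewrite -defA'.
    by rewrite /X wpowSr -!catA catA prefix_prefix.
  by rewrite -defA' size_cat size_wpow; lia.
by rewrite prefix_catr // eqxx.
Qed.

(** Bounded distance forces periods of equal length and an overlap long enough for conjugacy. If
    [A'] is the longer head, [V m] becomes [A B^m E C']; the factor [A B^m] cancels against [W m],
    and only [C] and [E C'] remain. The other case is symmetric. *)
Lemma lquot_lcp_pumped (A B C A' B' C' : seq Γ) D :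
    let W m := A ++ wpow B m ++ C in let V m := A' ++ wpow B' m ++ C' in
    (forall m, wdist (W m) (V m) <= D) ->
  forall m, lquot (lcp (W m) (V m)) (W m) = lquot (lcp (W 0) (V 0)) (W 0).
Proof.
move=> W V bounded.
have sizeW m : size (W m) = size A + m * size B + size C.
  by rewrite !size_cat size_wpow addnA.
have sizeV m : size (V m) = size A' + m * size B' + size C'.
  by rewrite !size_cat size_wpow addnA.
have lcpW m : size (W m) <= size (lcp (W m) (V m)) + D.
  have := bounded m; rewrite /wdist.
  by have := size_lcpl (W m) (V m); have := size_lcpr (W m) (V m); lia.
have eqB : size B = size B'.
  (* Periods of different lengths would make the sizes of [W k] and [V k] differ by more than
     [D]. *)
  pose k := (D + size A + size A' + size C + size C').+1.
  have := bounded k; rewrite /wdist; have := size_lcpl (W k) (V k).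
  by have := size_lcpr (W k) (V k); rewrite !sizeW !sizeV /k; nia.
have [B0|B_gt0] := posnP (size B).
  have [B_nil B'_nil] : B = [::] /\ B' = [::].
    by split; apply: size0nil; rewrite -?eqB.
  by move=> m; rewrite /W /V B_nil B'_nil !wpow_nil.
(* As [B] is nonempty, the power [k.+1] leaves a common prefix beyond both heads and one period,
   even after a loss of [D] letters. *)
pose k := D + size A + size A'.
have k_large : size A + size A' + size B <= size (lcp (W k.+1) (V k.+1)).
  by have := lcpW k.+1; rewrite sizeW /k; nia.
have [leA|/ltnW leA'] := leqP (size A) (size A').
  have [||E defA' EB] := @pumped_conj A B C A' B' C' k leA eqB.
  - by rewrite /k; nia.
  - by apply: leq_trans k_large; rewrite -eqB; lia.
  have quotW m : lquot (lcp (W m) (V m)) (W m) = lquot (lcp C (E ++ C')) C.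
    have -> : V m = A ++ wpow B m ++ E ++ C'.
      by rewrite /V defA' (catA (wpow B m)) -(wpow_conj _ EB) -!catA.
    by rewrite /W !lcp_cat !lquot_catC.
  by move=> m; rewrite !quotW.
have [||E defA EB] := @pumped_conj A' B' C' A B C k leA' (esym eqB).
- by rewrite /k; nia.
- by rewrite lcpC; apply: leq_trans k_large; lia.
have quotW m : lquot (lcp (W m) (V m)) (W m) = lquot (lcp (E ++ C) C') (E ++ C).
  have -> : W m = A' ++ wpow B' m ++ E ++ C.
    by rewrite /W defA (catA (wpow B' m)) -(wpow_conj _ EB) -!catA.
  by rewrite /V !lcp_cat !lquot_catC.
by move=> m; rewrite !quotW.
Qed.

(** Additivity makes [g n] a prefix of [g n.+1]; let [B] be the rest. Then [g n ++ g c.+1 = g c ++ g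
    n.+1 = g n ++ g c ++ B], and cancelling [g n] shows that each further step appends [B]. *)
Lemma additive_words (g : nat -> seq Γ) n : 0 < n ->
    (forall c d, n <= c -> n <= d -> g (c + d) = g c ++ g d) ->
  exists B, forall m, g (n + m) = g n ++ wpow B m.
Proof.
move=> n_gt0 gD.
have size_g c k : n <= c -> size (g (k.+1 * c)) = k.+1 * size (g c).
  move=> le_nc; elim: k => [|k IHk]; first by rewrite !mul1n.
  by rewrite mulSn gD ?size_cat ?IHk ?[RHS]mulSn //; nia.
have [|B defB] := prefixP (_ : prefix (g n) (g n.+1)).
  apply: (@prefix_comparable _ _ (g (n + n.+1))).
  - by rewrite gD // prefix_prefix.
  - by rewrite addnC gD // prefix_prefix.
  (* The size of [g (n * n.+1)] is computed in two ways, so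
     [n.+1 * size (g n) = n * size (g n.+1)]. *)
  have := size_g n n (leqnn n); have := size_g n.+1 n.-1 (leqnSn n).
  by rewrite prednK // mulnC => ->; nia.
have gS c : n <= c -> g c.+1 = g c ++ B.
  move=> le_nc; apply: (@cat_injl (g n)); rewrite -gD ?(leqW le_nc) //.
  by rewrite addnS -addnS addnC addSnnS gD // defB !catA -!gD // addnC.
exists B; elim=> [|m IHm]; first by rewrite addn0 cats0.
by rewrite addnS gS ?leq_addr // IHm wpowSr catA.
Qed.

End WordCombinatorics.

(** * Runs of automata and stabilization of powers *)

Section Automata.
Variables (Σ : Type) (A : automaton Σ).
Implicit Types (p q r : st A) (u v w : seq Σ).

Lemma reach_nilE p q : reach A p [::] q <-> p = q.
Proof.
split=> [|->]; last exact: reach_nil.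
by move E : [::] => u pq; case: pq E.
Qed.

Lemma reach_consE p a u q :
  reach A p (a :: u) q <-> exists2 r, tr p a r & reach A r u q.
Proof.
split=> [|[r pr rq]]; last exact: reach_cons pr rq.
move E : (a :: u) => w pq; case: pq E => // p0 b r v q0 pr rq [-> ->].
by exists r.
Qed.

Lemma reach_catE p u v q :
  reach A p (u ++ v) q <-> exists2 r, reach A p u r & reach A r v q.
Proof.
elim: u p => [|a u IHu] p /=.
  by split=> [pq|[r /reach_nilE <-]//]; exists p => //; apply: reach_nil.
split=> [/reach_consE[s ps /IHu[r sr rq]]|[r /reach_consE[s ps sr] rq]].
  by exists r => //; apply: reach_cons ps sr.
by apply: reach_cons ps _; apply/IHu; exists r.
Qed.

Lemma aut_equiv_refl u : aut_equiv A u u.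
Proof. by []. Qed.

Lemma aut_equiv_trans u v w :
  aut_equiv A u v -> aut_equiv A v w -> aut_equiv A u w.
Proof. by move=> uv vw p q; apply: iff_trans (uv p q) (vw p q). Qed.

Lemma aut_equiv_sym u v : aut_equiv A u v -> aut_equiv A v u.
Proof. by move=> uv p q; apply: iff_sym. Qed.

Lemma aut_equiv_cat u v u' v' :
  aut_equiv A u v -> aut_equiv A u' v' -> aut_equiv A (u ++ u') (v ++ v').
Proof.
move=> uv uv' p q; split=> /reach_catE[r pr rq]; apply/reach_catE; exists r.
- exact/uv.
- exact/uv'.
- exact/uv.
- exact/uv'.
Qed.

Lemma aut_equiv_wpow_ge w n m : aut_equiv A (wpow w n) (wpow w n.+1) ->
  n <= m -> aut_equiv A (wpow w n) (wpow w m).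
Proof.
move=> stab /subnKC <-; elim: (m - n) => [|k IHk]; first by rewrite addn0.
apply: aut_equiv_trans stab _; rewrite addnS !wpowSr.
by apply: aut_equiv_cat.
Qed.

(** The threshold is raised by one to make it positive, as is required later by [additive_words] and
    to keep powers of nonempty words nonempty. *)
Lemma aperiodic_autP : aperiodic_aut A <->
  exists2 n, 0 < n & forall w m k, n <= m -> n <= k -> aut_equiv A (wpow w m) (wpow w k).
Proof.
split=> [[n stab]|[n n_gt0 stab]]; last by exists n => w; apply: stab.
exists n.+1 => // w m k lt_nm lt_nk.
apply: aut_equiv_trans (aut_equiv_sym _) _; apply: aut_equiv_wpow_ge (ltnW _) => //.
Qed.

End Automata.

Lemma reach_wpow_states (Σ : Type) (A : automaton Σ) (p q : st A) u N :
    reach A p (wpow u N) q ->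
  exists g : nat -> st A, [/\ g 0 = p, g N = q &
    forall i k, i + k <= N -> reach A (g i) (wpow u k) (g (i + k))].
Proof.
elim: N p => [|N IHN] p.
  move/reach_nilE=> eq_pq; exists (fun=> p); split=> // i [|k]; last by rewrite addnS.
  by move=> _; apply: reach_nil.
move=> /reach_catE[r pr /IHN[g [g0 gN g_reach]]].
exists (fun i => if i is j.+1 then g j else p); split=> // -[|i] k le_kN; last first.
  exact: g_reach.
case: k le_kN => [|k] le_kN; first exact: reach_nil.
by apply/reach_catE; exists r => //; rewrite -g0; apply: (g_reach 0).
Qed.

Lemma reach_wpow_loop (Σ : Type) (A : automaton Σ) (r : st A) w n :
  reach A r w r -> reach A r (wpow w n) r.
Proof.
move=> rr; elim: n => [|n IHn]; first exact: reach_nil.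
by apply/reach_catE; exists r.
Qed.

(** * The congruences [lharp] and [simL], and the action of words on their classes *)

Section CanonicalBimachine.
Variables (Σ : Type) (Γ : eqType) (f : seq Σ -> option (seq Γ)).
Implicit Types (u v w : seq Σ) (x y z : seq Γ).

Lemma indomP u : indom f u <-> exists y, f u = Some y.
Proof.
by rewrite /indom; split=> [|[y ->]//]; case: (f u) => [y _|//]; exists y.
Qed.

Lemma lharp_refl u : lharp f u u.
Proof.
by split=> //; exists 0 => w x y -> [->]; have := wdist_cat y [::] [::]; rewrite !cats0.
Qed.

Lemma lharp_sym u v : lharp f u v -> lharp f v u.
Proof.
case=> domE [B bB]; split=> [w|]; first exact: iff_sym.
by exists B => w x y fx fy; rewrite wdistC; apply: bB fy fx.
Qed.

Lemma lharp_trans u v w : lharp f u v -> lharp f v w -> lharp f u w.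
Proof.
case=> domE [B bB] [domE' [B' bB']]; split=> [t|]; first exact: iff_trans.
exists (B + B') => t x z fx fz.
have /domE/indomP[y fy] : indom f (t ++ u) by rewrite /indom fx.
apply: leq_trans (wdist_triangle x y z) _.
by apply: leq_add; [apply: bB fx fy | apply: bB' fy fz].
Qed.

Lemma lharp_eqE u v : lharp f u = lharp f v <-> lharp f u v.
Proof.
split=> [->|uv]; first exact: lharp_refl.
apply: funext => w; apply: propext; split; apply: lharp_trans => //.
exact: lharp_sym.
Qed.

Lemma lharp_catl w u v : lharp f u v -> lharp f (w ++ u) (w ++ v).
Proof.
case=> domE [B bB]; split=> [t|]; first by rewrite !catA.
by exists B => t x y; rewrite !catA; apply: bB.
Qed.

Lemma fhat_eq w w' u : lharp f w w' -> fhat f w u = fhat f w' u.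
Proof.
move=> ww'; congr bigwedge; apply: funext => x; apply: propext.
split=> -[v [vw fx]]; exists v; split=> //; apply: lharp_trans vw _ => //.
exact: lharp_sym.
Qed.

Lemma fhat_prefix w u x : f (u ++ w) = Some x -> prefix (fhat f w u) x.
Proof.
by move=> fx; apply: bigwedge_prefix; exists w; split=> //; apply: lharp_refl.
Qed.

Lemma fhat_nil_out w u : ~ indom f (u ++ w) -> fhat f w u = [::].
Proof.
move=> nd; apply: bigwedge_empty => -[x [v [[domE _] fx]]]; apply: nd.
by apply/domE; rewrite /indom fx.
Qed.

(** If [v] is [lharp]-related to [w], then [a :: v] is to [a :: w]. So [fhat f (a :: w) u] is a
    prefix of every output in the meet for [rcons u a] and factors out; the cofactor is the
    transition output of the canonical bimachine. *)
Lemma fhat_rcons w u a : indom f (u ++ a :: w) ->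
  fhat f w (rcons u a) =
    fhat f (a :: w) u ++ bigwedge (fun z => exists v, lharp f v w /\
      f (u ++ a :: v) = Some (fhat f (a :: w) u ++ z)).
Proof.
move=> /indomP[x fx]; rewrite [LHS](@bigwedge_cat _ _ (fhat f (a :: w) u)).
- congr (_ ++ bigwedge _); apply: funext => z; apply: propext.
  by split=> -[v [vw fz]]; exists v; rewrite cat_rcons in fz *.
- by exists x, w; rewrite cat_rcons; split=> //; apply: lharp_refl.
move=> y [v [vw]]; rewrite cat_rcons => fy.
by rewrite (fhat_eq _ (lharp_catl [:: a] (lharp_sym vw))); apply: fhat_prefix.
Qed.

Lemma simL_refl u : simL f u u.
Proof. by move=> w; split=> // x y -> [->]. Qed.

Lemma simL_sym u v : simL f u v -> simL f v u.
Proof.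
move=> uv w; have [domE quotE] := uv w; split; first exact: iff_sym.
by move=> x y fx fy; apply/esym/quotE.
Qed.

Lemma simL_trans u v w : simL f u v -> simL f v w -> simL f u w.
Proof.
move=> uv vw t; have [domE quotE] := uv t; have [domE' quotE'] := vw t.
split=> [|x z fx fz]; first exact: iff_trans domE domE'.
have /domE/indomP[y fy] : indom f (u ++ t) by rewrite /indom fx.
exact: etrans (quotE _ _ fx fy) (quotE' _ _ fy fz).
Qed.

Lemma simL_eqE u v : simL f u = simL f v <-> simL f u v.
Proof.
split=> [->|uv]; first exact: simL_refl.
apply: funext => w; apply: propext; split; apply: simL_trans => //.
exact: simL_sym.
Qed.

Lemma simL_output u v w z : simL f u v ->
  f (u ++ w) = Some (fhat f w u ++ z) -> f (v ++ w) = Some (fhat f w v ++ z).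
Proof.
move=> uv fu; have [domE quotE] := uv w.
have /domE/indomP[y fy] : indom f (u ++ w) by rewrite /indom fu.
by rewrite fy -(cat_lquot (fhat_prefix fy)) -(quotE _ _ fu fy) lquot_cat.
Qed.

(** The transition output is well defined on left classes: the cofactor in [fhat_rcons] is a meet of
    remainders of outputs, which [simL] preserves. *)
Lemma simL_lquot_fhat u v w a : simL f u v ->
  lquot (fhat f (a :: w) u) (fhat f w (rcons u a)) =
  lquot (fhat f (a :: w) v) (fhat f w (rcons v a)).
Proof.
move=> uv; have [domE _] := uv (a :: w).
have [du|nd] := EM (indom f (u ++ a :: w)); last first.
  (* Outside the domain the meets for [rcons u a] and [rcons v a] are over empty languages, hence
     empty. *)
  by rewrite !(@fhat_nil_out w) ?cat_rcons // => /domE.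
have dv : indom f (v ++ a :: w) by apply/domE.
rewrite !fhat_rcons // !lquot_cat; congr bigwedge.
apply: funext => z; apply: propext.
split=> -[v' [vw fz]]; exists v'; split=> //; move: fz;
  rewrite !(fhat_eq _ (lharp_catl [:: a] (lharp_sym vw))) => fz.
  exact: simL_output uv fz.
exact: simL_output (simL_sym uv) fz.
Qed.

(** The remainder after [rcons u a] is the remainder after [u] with the transition output removed,
    and both depend only on the left class. This makes [Leftf f] deterministic. *)
Lemma simL_rcons u v a : simL f u v -> simL f (rcons u a) (rcons v a).
Proof.
move=> uv w; have [domE quotE] := uv (a :: w); rewrite !cat_rcons; split=> // x y fx fy.
have quot_rcons t z : f (t ++ a :: w) = Some z ->
    lquot (fhat f w (rcons t a)) z =
    lquot (lquot (fhat f (a :: w) t) (fhat f w (rcons t a))) (lquot (fhat f (a :: w) t) z).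
  move=> fz; rewrite -[z in LHS](cat_lquot (fhat_prefix fz)).
  by rewrite fhat_rcons ?/indom ?fz // lquot_catC lquot_cat.
by rewrite !quot_rcons // (simL_lquot_fhat w a uv) (quotE _ _ fx fy).
Qed.

Lemma simL_catr u v w : simL f u v -> simL f (u ++ w) (v ++ w).
Proof.
elim: w u v => [|a w IHw] u v uv; first by rewrite !cats0.
by rewrite -!cat_rcons; apply/IHw/simL_rcons.
Qed.

Lemma qstate_inj (E : seq Σ -> seq Σ -> Prop) (p q : qstate E) :
  proj1_sig p = proj1_sig q -> p = q.
Proof. by case: p q => [P hP] [Q hQ] /= PQ; apply: eq_exist. Qed.

(** Each transition may pick its own representative; since [lharp] is a left congruence, a single
    one serves for the whole run. *)
Lemma reach_RfE (p q : st (Rf f)) u : reach (Rf f) p u q <->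
  exists w, proj1_sig p = lharp f (u ++ w) /\ proj1_sig q = lharp f w.
Proof.
elim: u p => [|a u IHu] p.
  split=> [/reach_nilE->|[w [defp defq]]]; first by case: (proj2_sig q) => w ?; exists w.
  by apply/reach_nilE/qstate_inj; rewrite defp defq.
split=> [/reach_consE[r [v [defp defr]] /IHu[w [defr' defq]]]|[w [defp defq]]].
  exists w; split=> //; rewrite defp; apply/lharp_eqE/(lharp_catl [:: a])/lharp_eqE.
  by rewrite -defr defr'.
pose r : st (Rf f) := exist _ (lharp f (u ++ w)) (ex_intro _ (u ++ w) erefl).
by apply/reach_consE; exists r; [exists (u ++ w) | apply/IHu; exists w].
Qed.

Lemma reach_LeftfE (p q : st (Leftf f)) u : reach (Leftf f) p u q <->
  exists w, proj1_sig p = simL f w /\ proj1_sig q = simL f (w ++ u).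
Proof.
elim: u p => [|a u IHu] p.
  split=> [/reach_nilE->|[w [defp defq]]].
    by case: (proj2_sig q) => w ?; exists w; rewrite cats0.
  by apply/reach_nilE/qstate_inj; rewrite defp defq cats0.
split=> [/reach_consE[r [v [defp defr]] /IHu[w [defr' defq]]]|[w [defp defq]]].
  exists v; split=> //; rewrite defq -cat_rcons; apply/simL_eqE/simL_catr/simL_eqE.
  by rewrite -defr' defr.
pose r : st (Leftf f) := exist _ (simL f (rcons w a)) (ex_intro _ (rcons w a) erefl).
apply/reach_consE; exists r; first by exists w.
by apply/IHu; exists (rcons w a); rewrite cat_rcons.
Qed.

Lemma aut_equiv_RfE u v :
  aut_equiv (Rf f) u v <-> forall w, lharp f (u ++ w) (v ++ w).
Proof.
split=> [uv w|uv p q].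
  pose cl t : st (Rf f) := exist _ (lharp f t) (ex_intro _ t erefl).
  have /uv/reach_RfE[t [/= eq_u eq_w]] : reach (Rf f) (cl (u ++ w)) u (cl w).
    by apply/reach_RfE; exists w.
  apply: lharp_trans (lharp_catl v (_ : lharp f t w)); first exact/lharp_eqE.
  exact/lharp_eqE.
by split=> /reach_RfE[w [defp defq]]; apply/reach_RfE; exists w; split=> //;
  rewrite defp; apply/lharp_eqE => //; apply: lharp_sym.
Qed.

Lemma aut_equiv_LeftfE u v :
  aut_equiv (Leftf f) u v <-> forall w, simL f (w ++ u) (w ++ v).
Proof.
split=> [uv w|uv p q].
  pose cl t : st (Leftf f) := exist _ (simL f t) (ex_intro _ t erefl).
  have /uv/reach_LeftfE[t [/= eq_w eq_u]] : reach (Leftf f) (cl w) u (cl (w ++ u)).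
    by apply/reach_LeftfE; exists w.
  apply: simL_trans (simL_catr v (_ : simL f t w)); first exact/simL_eqE.
  exact/simL_eqE.
by split=> /reach_LeftfE[w [defp defq]]; apply/reach_LeftfE; exists w; split=> //;
  rewrite defq; apply/simL_eqE => //; apply: simL_sym.
Qed.

End CanonicalBimachine.

(** * Outputs of partial runs, finiteness of [lharp], and bounds on delays *)

Section Transducer.
Variables (Σ : finType) (Γ : eqType) (T : transducer Σ Γ) (f : seq Σ -> option (seq Γ)).
Implicit Types (p q r : tQ T) (u v w : seq Σ) (x y z : seq Γ).

Lemma trun_nilE p q z : trun T p [::] q z <-> p = q /\ z = [::].
Proof.
split=> [|[-> ->]]; last exact: trun_nil.
by move E : [::] => u pq; case: pq E.
Qed.

Lemma trun_consE p a u q z : trun T p (a :: u) q z <->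
  exists r x, [/\ tdelta p a r, trun T r u q x & z = tout p a r ++ x].
Proof.
split=> [|[r [x [par rq ->]]]]; last exact: trun_cons.
move E : (a :: u) => w pq; case: pq E => // p0 b r v q0 x pbr rq [-> ->].
by exists r, x.
Qed.

Lemma trun_catE p u v q z : trun T p (u ++ v) q z <->
  exists r x y, [/\ trun T p u r x, trun T r v q y & z = x ++ y].
Proof.
elim: u p z => [|a u IHu] p z /=.
  split=> [pq|[r [x [y [/trun_nilE[-> ->] rq ->]]]]] //.
  by exists p, [::], z; split=> //; apply: trun_nil.
split=> [/trun_consE[s [t [pas /IHu[r [x [y [sr rq ->]]]] ->]]]|].
  by exists r, (tout p a s ++ x), y; split; rewrite ?catA //; apply: trun_cons.
move=> [r [_ [y [/trun_consE[s [x [pas sr ->]]] rq ->]]]].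
by rewrite -catA; apply: trun_cons => //; apply/IHu; exists r, x, y.
Qed.

Lemma reach_underlyingE p u q :
  reach (underlying T) p u q <-> exists x, trun T p u q x.
Proof.
split=> [|[x]]; elim=> {p u q}.
- by move=> p; exists [::]; apply: trun_nil.
- by move=> p a s u q pas _ [x sq]; exists (tout p a s ++ x); apply: trun_cons.
- by move=> p; apply: reach_nil.
- by move=> p a s u q y pas _ sq; apply: (@reach_cons _ (underlying T)) pas sq.
Qed.

Definition out_to u q z :=
  exists p i x, [/\ tinit p = Some i, trun T p u q x & z = i ++ x].

Definition out_from q u z :=
  exists r o x, [/\ tfinal r = Some o, trun T q u r x & z = x ++ o].

Lemma out_to_catE u v q z : out_to (u ++ v) q z <->
  exists r x y, [/\ out_to u r x, trun T r v q y & z = x ++ y].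
Proof.
split=> [[p [i [t [ini_p /trun_catE[r [x [y [pr rq ->]]]] ->]]]]|].
  exists r, (i ++ x), y; split; rewrite ?catA //.
  by exists p, i, x.
move=> [r [_ [y [[p [i [x [ini_p pr ->]]]] rq ->]]]].
exists p, i, (x ++ y); split; rewrite ?catA //.
by apply/trun_catE; exists r, x, y.
Qed.

Lemma out_from_catE q u v z : out_from q (u ++ v) z <->
  exists r x y, [/\ trun T q u r x, out_from r v y & z = x ++ y].
Proof.
split=> [[s [o [t [fin_s /trun_catE[r [x [y [qr rs ->]]]] ->]]]]|].
  exists r, x, (y ++ o); split; rewrite ?catA //.
  by exists s, o, y.
move=> [r [x [_ [qr [s [o [y [fin_s rs ->]]]] ->]]]].
exists s, o, (x ++ y); split; rewrite ?catA //.
by apply/trun_catE; exists r, x, y.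
Qed.

Lemma out_from_bound : exists K, forall q u z, out_from q u z -> size z <= K * (size u).+1.
Proof.
have [K1 bK1] : exists K, forall t : tQ T * Σ * tQ T, size (tout t.1.1 t.1.2 t.2) <= K.
  apply: (uniform_bound (P := fun t K => size (tout t.1.1 t.1.2 t.2) <= K)) => [t m n|t].
    by move=> ? /leq_trans; apply.
  by eexists.
have [K2 bK2] : exists K, forall r : tQ T, size (odflt [::] (tfinal r)) <= K.
  apply: (uniform_bound (P := fun r K => size (odflt [::] (tfinal r)) <= K)) => [t m n|t].
    by move=> ? /leq_trans; apply.
  by eexists.
exists (K1 + K2) => q u z [r [o [x [fin_r qr ->]]]]; rewrite size_cat.
have: size o <= K2 by have := bK2 r; rewrite fin_r.
suff : size x <= K1 * size u by nia.
elim: {fin_r} qr => // p a s {}u {}r y _ _; rewrite size_cat /=.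
by have := bK1 (p, a, s) => /=; nia.
Qed.

Hypothesis Tf : realizes T f.

Lemma realizes_catE u v y : f (u ++ v) = Some y <->
  exists q z1 z2, [/\ out_to u q z1, out_from q v z2 & y = z1 ++ z2].
Proof.
split=> [/Tf[p [r [i [o [x [ini_p [fin_r [/trun_catE[q [z1 [z2 [pq qr ->]]]] ->]]]]]]]]|].
  exists q, (i ++ z1), (z2 ++ o); split; last by rewrite -!catA.
    by exists p, i, z1.
  by exists r, o, z2.
move=> [q [_ [_ [[p [i [x [ini_p pq ->]]]] [r [o [y' [fin_r qr ->]]]] ->]]]].
apply/Tf; exists p, r, i, o, (x ++ y'); rewrite -!catA; do !split=> //.
by apply/trun_catE; exists q, x, y'.
Qed.

Lemma realizes_cat u v q z1 z2 :
  out_to u q z1 -> out_from q v z2 -> f (u ++ v) = Some (z1 ++ z2).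
Proof. by move=> uq qv; apply/realizes_catE; exists q, z1, z2. Qed.

(** By functionality [f (w ++ u)] and [f (w ++ v)] can be read along runs sharing the part on [w].
    They differ only after the output of that part, by a length independent of [w]. *)
Lemma lharp_out_from u v :
    (forall q, (exists z, out_from q u z) <-> (exists z, out_from q v z)) ->
  lharp f u v.
Proof.
move=> uv; split=> [w|].
  split=> /indomP[y /realizes_catE[q [z1 [z2 [wq qu _]]]]]; apply/indomP.
    have /uv[z2' qv] : exists z, out_from q u z by exists z2.
    by exists (z1 ++ z2'); apply: realizes_cat qv.
  have /uv[z2' qv] : exists z, out_from q v z by exists z2.
  by exists (z1 ++ z2'); apply: realizes_cat qv.
have [K bK] := out_from_bound; exists (K * (size u).+1 + K * (size v).+1) => w x y.
move=> /realizes_catE[q [z1 [z2 [wq qu ->]]]].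
have /uv[z2' qv] : exists z, out_from q u z by exists z2.
rewrite (realizes_cat wq qv) => -[<-]; apply: leq_trans (wdist_cat _ _ _) _.
by apply: leq_add; [apply: bK qu | apply: bK qv].
Qed.

Lemma aut_equiv_out_from u v w q : aut_equiv (underlying T) u v ->
  (exists z, out_from q (u ++ w) z) -> exists z, out_from q (v ++ w) z.
Proof.
move=> uv [z /out_from_catE[r [x [y [qr rw _]]]]].
have /uv/reach_underlyingE[x' qr'] : reach (underlying T) q u r.
  by apply/reach_underlyingE; exists x.
by exists (x' ++ y); apply/out_from_catE; exists r, x', y.
Qed.

Lemma aut_equiv_lharp u v w :
  aut_equiv (underlying T) u v -> lharp f (u ++ w) (v ++ w).
Proof.
move=> uv; apply: lharp_out_from => q.
by split; apply: aut_equiv_out_from => //; apply: aut_equiv_sym.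
Qed.

Lemma aut_equiv_indom t u v w : aut_equiv (underlying T) u v ->
  indom f (t ++ u ++ w) <-> indom f (t ++ v ++ w).
Proof. by move=> uv; have [] := aut_equiv_lharp w uv. Qed.

Lemma lharp_finite :
  exists (X : finType) (h : seq Σ -> X), forall u v, h u = h v -> lharp f u v.
Proof.
exists {set tQ T}, (fun u => [set q | `[< exists z, out_from q u z >]]) => u v /setP eq_uv.
apply: lharp_out_from => q; have := eq_uv q; rewrite !inE => eq_q.
by split=> /asboolP qz; apply/asboolP; rewrite ?eq_q // -eq_q.
Qed.

(** For each value [c] of [h] and each state [q], fix one word of value [c] accepted from [q], with
    output [z0]. Then [fhat f w u] is a prefix of [z1 ++ z0], where [z0] does not depend on [u]. *)
Lemma fhat_le_out_to (X : finType) (h : seq Σ -> X) :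
  (forall u v, h u = h v -> lharp f u v) -> exists K, forall u w q z1 z2,
  out_to u q z1 -> out_from q w z2 -> size (fhat f w u) <= size z1 + K.
Proof.
move=> hP.
suff [K bK] : exists K, forall c : X * tQ T, forall u w z1 z2, h w = c.1 ->
    out_to u c.2 z1 -> out_from c.2 w z2 -> size (fhat f w u) <= size z1 + K.
  by exists K => u w q z1 z2; apply: (bK (h w, q) u w z1 z2 erefl).
apply: uniform_bound => [c m n le_mn bm u w z1 z2 hw uq qw|[c q] /=].
  by apply: leq_trans (bm u w z1 z2 hw uq qw) _; rewrite leq_add2l.
have [[v0 [z0 [hv qv]]]|none] := EM (exists v z, h v = c /\ out_from q v z); last first.
  by exists 0 => u w z1 z2 hw uq qw; case: none; exists w, z2.
exists (size z0) => u w z1 z2 hw uq qw.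
rewrite (fhat_eq _ (hP _ _ (etrans hw (esym hv)))) -size_cat.
exact: size_prefix (fhat_prefix (realizes_cat uq qv)).
Qed.

(** For each pair of states, fix [lharp]-related words [v0] and [v0'] accepted from them. Their
    distance bound [D] holds for every [u], so [z1] and [z1'] agree up to a bounded suffix, whatever
    [v] and [v'] are. *)
Lemma out_to_le_lcp : exists K, forall u v v' q q' z1 z2 z1' z2', lharp f v v' ->
  out_to u q z1 -> out_from q v z2 -> out_to u q' z1' -> out_from q' v' z2' ->
  size z1 <= size (lcp z1 (z1' ++ z2')) + K.
Proof.
suff [K bK] : exists K, forall qq : tQ T * tQ T, forall u v v' z1 z2 z1' z2',
    lharp f v v' -> out_to u qq.1 z1 -> out_from qq.1 v z2 ->
    out_to u qq.2 z1' -> out_from qq.2 v' z2' ->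
    size z1 <= size (lcp z1 (z1' ++ z2')) + K.
  by exists K => u v v' q q'; apply: (bK (q, q')).
apply: uniform_bound => [qq m n le_mn bm u v v' z1 z2 z1' z2' vv' uq qv uq' qv'|[q q'] /=].
  by apply: leq_trans (bm u v v' z1 z2 z1' z2' _ _ _ _ _) _ => //; rewrite leq_add2l.
have [[v0 [v0' [z0 [z0' [vv0 qv0 qv0']]]]]|none] := EM (exists v v' z z',
    [/\ lharp f v v', out_from q v z & out_from q' v' z']); last first.
  exists 0 => u v v' z1 z2 z1' z2' vv' _ qv _ qv'; case: none.
  by exists v, v', z2, z2'.
have [_ [D bD]] := vv0; exists (D + size z0') => u v v' z1 z2 z1' z2' _ uq _ uq' _.
have := bD u _ _ (realizes_cat uq qv0) (realizes_cat uq' qv0'); rewrite /wdist.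
set l := lcp _ _.
have l_pre : prefix l (z1 ++ z0) := lcp_prefixl _ _.
have l_pre' : prefix l (z1' ++ z0') := lcp_prefixr _ _.
have := size_prefix l_pre; have := size_prefix l_pre'; rewrite !size_cat => le1 le2 leD.
have take_pre k y : prefix (take k y) y by apply: prefix_take.
(* This cut is short enough to lie inside both [z1] and [z1'], away from the fixed tails [z0] and
   [z0']. *)
pose k := size z1 - (D + size z0').
have : prefix (take k l) (lcp z1 (z1' ++ z2')).
  have lek : size (take k l) <= size z1 /\ size (take k l) <= size z1'.
    by rewrite !size_take_min /k; lia.
  rewrite prefix_lcp; apply/andP; split; last apply: prefix_catl.
    apply: prefix_comparable (prefix_prefix z1 z0) lek.1.
    exact: prefix_trans (take_pre _ _) l_pre.
  apply: prefix_comparable (prefix_prefix z1' z0') lek.2.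
  exact: prefix_trans (take_pre _ _) l_pre'.
by move/size_prefix; rewrite size_take_min /k; lia.
Qed.

(** By [out_to_le_lcp], [z1] without its last [K] letters is a prefix of all the outputs whose meet
    is [fhat f w u]. *)
Lemma out_to_le_fhat : exists K, forall u w q z1 z2,
  out_to u q z1 -> out_from q w z2 -> size z1 <= size (fhat f w u) + K.
Proof.
have [K bK] := out_to_le_lcp; exists K => u w q z1 z2 uq qw.
suff /size_prefix : prefix (take (size z1 - K) z1) (fhat f w u).
  by rewrite size_take_min; lia.
apply: prefix_bigwedge.
  by exists (z1 ++ z2), w; split; [apply: lharp_refl | apply: realizes_cat qw].
move=> y [v [vw /realizes_catE[q' [z1' [z2' [uq' qv' ->]]]]]].
apply: prefix_trans (lcp_prefixr z1 _).
apply: prefix_comparable (prefix_take _ _) (lcp_prefixl _ _) _.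
by have := bK _ _ _ _ _ _ _ _ _ (lharp_sym vw) uq qw uq' qv'; rewrite size_take_min; lia.
Qed.

End Transducer.

(** The invariant [g u] records, for each right class and each state reached on [u], the delay
    between the output so far and [fhat], as a pair of words of length at most [K]. If [g u = g u'],
    a run through [q] on [u] is matched by one on [u'] with the same delay, and the same suffix run
    from [q] then leaves the same remainder. *)
Lemma simL_finite (Σ Γ : finType) (T : transducer Σ Γ) (f : seq Σ -> option (seq Γ)) :
    realizes T f ->
  exists (Y : finType) (g : seq Σ -> Y), forall u v, g u = g v -> simL f u v.
Proof.
move=> Tf; have [X [h hP]] := lharp_finite Tf.
have [K1 bK1] := fhat_le_out_to Tf hP; have [K2 bK2] := out_to_le_fhat Tf.
pose K := K1 + K2.
pose Y : finType := (X * tQ T * K.-bseq Γ * K.-bseq Γ)%type.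
pose g u := [set t : Y | `[< exists z v,
  [/\ out_to u t.1.1.2 z, h v = t.1.1.1 & z ++ t.2 = fhat f v u ++ t.1.2] >]].
exists {set Y}, g.
suff same_quot u u' : g u = g u' -> forall w x, f (u ++ w) = Some x ->
    exists2 y, f (u' ++ w) = Some y & lquot (fhat f w u) x = lquot (fhat f w u') y.
- move=> u u' guu' w; have uu' := same_quot _ _ guu'; have u'u := same_quot _ _ (esym guu').
  split=> [|x y /uu'[y' -> ->] [<-]//].
  by split=> /indomP[x fx]; apply/indomP; [have [y] := uu' _ _ fx | have [y] := u'u _ _ fx];
    exists y.
move=> /setP guu' w x /(realizes_catE Tf)[q [z1 [z2 [uq qw ->]]]].
set F := fhat f w u.
have F_pre : prefix F (z1 ++ z2) by apply: fhat_prefix (realizes_cat Tf uq qw).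
have sz1 : size (lquot F z1) <= K.
  by rewrite size_drop leq_subLR (leq_trans (bK2 _ _ _ _ _ uq qw)) // leq_add2l leq_addl.
have sz2 : size (lquot z1 F) <= K.
  by rewrite size_drop leq_subLR (leq_trans (bK1 _ _ _ _ _ uq qw)) // leq_add2l leq_addr.
have := guu' (h w, q, Bseq sz1, Bseq sz2); rewrite !inE /= => /esym.
have z1_pre : prefix z1 (z1 ++ z2) by apply: prefix_prefix.
(* Both [z1] and [F] are prefixes of [z1 ++ z2], so they are comparable and one of the two delays is
   empty. *)
have bal : z1 ++ lquot z1 F = F ++ lquot F z1 /\ (lquot z1 F = [::] \/ lquot F z1 = [::]).
  have [leF|/ltnW leF] := leqP (size F) (size z1).
    have -> : lquot z1 F = [::] by apply: drop_oversize.
    by rewrite cats0 cat_lquot ?(prefix_comparable F_pre z1_pre) //; split=> //; left.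
  have -> : lquot F z1 = [::] by apply: drop_oversize.
  by rewrite cats0 cat_lquot ?(prefix_comparable z1_pre F_pre) //; split=> //; right.
case: bal => bal one_nil.
have -> : `[< exists z v, [/\ out_to u q z, h v = h w &
            z ++ lquot z1 F = fhat f v u ++ lquot F z1] >].
  by apply/asboolP; exists z1, w.
move/asboolP=> [z1' [v [u'q hv]]]; rewrite (fhat_eq _ (hP _ _ hv)) => bal'.
have f_u'w := realizes_cat Tf u'q qw; exists (z1' ++ z2) => //.
set F' := fhat f w u' in bal' *.
move: (lquot z1 F) (lquot F z1) bal bal' one_nil => s1 s2 bal bal' [nil|nil].
  by move: bal bal'; rewrite nil !cats0 => -> ->; rewrite -!catA !lquot_cat.
by move: bal bal'; rewrite nil !cats0 => <- <-; rewrite !lquot_catC.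
Qed.

(** * Pumping in an aperiodic transducer: the canonical bimachine is aperiodic *)

Section Pumping.
Variables (Σ : finType) (Γ : eqType) (T : transducer Σ Γ) (f : seq Σ -> option (seq Γ)).
Hypothesis Tf : realizes T f.
Variable n : nat.
Hypothesis n_gt0 : 0 < n.
Hypothesis stab : forall w m k, n <= m -> n <= k ->
  aut_equiv (underlying T) (wpow w m) (wpow w k).

(** Pigeonhole on the [M.+1] states met between consecutive copies of [u]. *)
Lemma repeated_state (p q : tQ T) u M :
    reach (underlying T) p (wpow u M) q -> #|tQ T| <= M ->
  exists r i k j, [/\ 0 < k, i + k + j = M, reach (underlying T) p (wpow u i) r,
    reach (underlying T) r (wpow u k) r & reach (underlying T) r (wpow u j) q].
Proof.
move=> /reach_wpow_states[g [<- <- g_reach]] leM.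
have : ~~ injectiveb (fun i : 'I_M.+1 => g i : tQ T).
  by apply/injectiveP=> /leq_card; rewrite card_ord; lia.
case/injectivePn=> i0 [j0 neq_ij eq_g].
have [i [j [lt_ij leM' eq_gij]]] : exists i j : nat, [/\ i < j, j <= M & g i = g j].
  have [lt_ij|lt_ji|/val_inj eq_ij] := ltngtP i0 j0; last by rewrite eq_ij eqxx in neq_ij.
    by exists i0, j0; split=> //; rewrite -ltnS ltn_ord.
  by exists j0, i0; split=> //; rewrite -ltnS ltn_ord.
exists (g i), i, (j - i), (M - j); split; [lia | lia | | |].
- by apply: (g_reach 0); lia.
- by rewrite {2}eq_gij -{2}(subnKC (ltnW lt_ij)); apply: g_reach; lia.
- by rewrite eq_gij -{2}(subnKC leM'); apply: g_reach; lia.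
Qed.

(** The number of states forces a repetition, one [n] makes the exponent [#|tQ T| + n] stable, and
    the other [n] lets the loop be read on at least [n] copies. *)
Let N0 := #|tQ T| + n + n.

Lemma pump t u w : indom f (t ++ wpow u N0 ++ w) ->
  exists A B C, forall m, f (t ++ wpow u (N0 + m) ++ w) = Some (A ++ wpow B m ++ C).
Proof.
move/indomP=> [y]; rewrite catA => /(realizes_catE Tf)[q [_ [z3 [/out_to_catE
  [p [z1 [z [tp pq _]]]] qw _]]]].
pose M := #|tQ T| + n.
have : reach (underlying T) p (wpow u M) q.
  by apply/(@stab u M N0); rewrite ?leq_addl //; apply/reach_underlyingE; exists z.
move=> /repeated_state[|r [i [k [j [k_gt0 eqM pr rr rq]]]]]; first exact: leq_addr.
(* The word [u^k] loops on [r], hence so does [u^(n * k)], which acts as [u^c] because both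
   exponents are at least [n]. *)
have loop c : n <= c -> exists x, trun T r (wpow u c) r x.
  move=> le_nc; apply/reach_underlyingE/(stab u le_nc (leq_pmulr n k_gt0)).
  by rewrite -wpow_mul; apply: reach_wpow_loop.
have [g gP] : {g : nat -> seq Γ & forall c, n <= c -> trun T r (wpow u c) r (g c)}.
  apply: (choice (P := fun c x => n <= c -> trun T r (wpow u c) r x)) => c; have [/loop[x rx]|_] := leqP n c; last by exists [::].
  by exists x.
have /reach_underlyingE[x1 pr1] := pr; have /reach_underlyingE[x2 rq2] := rq.
have out_f c x : trun T r (wpow u c) r x ->
    f (t ++ wpow u (i + c + j) ++ w) = Some ((z1 ++ x1) ++ x ++ x2 ++ z3).
  move=> rx; rewrite (_ : t ++ _ = (t ++ wpow u i) ++ (wpow u c ++ wpow u j ++ w)); last first.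
    by rewrite !wpowD -!catA.
  apply: (realizes_cat Tf (q := r)).
    by apply/out_to_catE; exists p, z1, x1.
  apply/out_from_catE; exists r, x, (x2 ++ z3); split=> //.
  by apply/out_from_catE; exists q, x2, z3.
(* Two runs on the same input differ only in the loop part, with outputs [g (c + d)] and
   [g c ++ g d]; functionality makes the whole outputs equal, and the common ends cancel. *)
have gD c d : n <= c -> n <= d -> g (c + d) = g c ++ g d.
  move=> le_nc le_nd; have rcd : trun T r (wpow u (c + d)) r (g c ++ g d).
    by rewrite wpowD; apply/trun_catE; exists r, (g c), (g d); split=> //; apply: gP.
  have := out_f _ _ rcd; rewrite (out_f _ (g (c + d))); last first.
    by apply: gP; rewrite (leq_trans le_nc) ?leq_addr.
  move=> [/cat_injl eq_out]; apply: (@prefix_size_eq _ _ _ (g (c + d) ++ x2 ++ z3)).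
  - exact: prefix_prefix.
  - by rewrite eq_out prefix_prefix.
  - by have := congr1 size eq_out; rewrite !size_cat; lia.
have [B gB] := additive_words n_gt0 gD.
exists ((z1 ++ x1) ++ g (n + k)), B, (x2 ++ z3) => m.
have -> : N0 + m = i + (n + k + m) + j by rewrite /N0 -/M -eqM; lia.
rewrite (out_f _ (g (n + k + m))); last by apply: gP; rewrite -addnA leq_addr.
by rewrite -addnA !gB wpowD -!catA.
Qed.

(** The bound in [lharp] is uniform over the left contexts [t ++ wpow u (N0 + m)], so
    [lquot_lcp_pumped] applies to the two pumped families. *)
Lemma pumped_lharp t u w v : lharp f v w -> indom f (t ++ wpow u N0 ++ w) ->
  exists W V : nat -> seq Γ,
    [/\ forall m, f (t ++ wpow u (N0 + m) ++ w) = Some (W m),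
        forall m, f (t ++ wpow u (N0 + m) ++ v) = Some (V m) &
        forall m, lquot (lcp (W m) (V m)) (W m) = lquot (lcp (W 0) (V 0)) (W 0)].
Proof.
move=> vw dw; have [domE [D bD]] := vw.
have dv : indom f (t ++ wpow u N0 ++ v).
  by rewrite catA; apply/domE; rewrite -catA.
have [A [B [C fW]]] := pump dw; have [A' [B' [C' fV]]] := pump dv.
eexists; eexists; split; [exact: fW | exact: fV |].
apply: (lquot_lcp_pumped (D := D)) => m; rewrite wdistC.
by apply: (bD (t ++ wpow u (N0 + m))); rewrite -catA.
Qed.

Lemma simL_wpow t u : simL f (t ++ wpow u N0) (t ++ wpow u N0.+1).
Proof.
move=> w; rewrite -(catA t (wpow u N0) w) -(catA t (wpow u N0.+1) w).
split=> [|x y fx fy].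
  by apply: (aut_equiv_indom Tf); apply: stab; rewrite /N0; lia.
have dw : indom f (t ++ wpow u N0 ++ w) by rewrite /indom fx.
pose L m z := exists v, lharp f v w /\ f (t ++ wpow u (N0 + m) ++ v) = Some z.
have fhatE m : fhat f w (t ++ wpow u (N0 + m)) = bigwedge (L m).
  congr bigwedge; apply: funext => z; apply: propext.
  by split=> -[v [vw fz]]; exists v; rewrite catA in fz *.
(* The word [v0] attains the meet at exponent [N0]; it is shown below to attain it at every
   [N0 + m]. *)
have [z0 [v0 [v0w fz0]] min0] : exists2 z, L 0 z & forall z', L 0 z' -> size (lcp x z) <= size (lcp x z').
  apply: exists_minimizer; exists x, w; rewrite addn0; split=> //.
  exact: lharp_refl.
have [W [V [fW fV quotWV]]] := pumped_lharp v0w dw.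
have W0 : W 0 = x by have := fW 0; rewrite addn0 fx => -[].
have V0 : V 0 = z0 by have := fV 0; rewrite fz0 => -[].
have bigL m : bigwedge (L m) = lcp (W m) (V m).
  apply: bigwedge_lcp; first by exists w; split=> //; apply: lharp_refl.
    by exists v0.
  (* For each competitor [v], the number of letters of [W m] beyond its common prefix with the
     output for [v] does not depend on [m]. Hence minimality at [0] carries over to [m]. *)
  move=> z [v [vw fz]]; have [W' [V' [fW' fV' quotWV']]] := pumped_lharp vw dw.
  have eqW k : W' k = W k by have := fW' k; rewrite fW => -[].
  have eqV' : V' m = z by have := fV' m; rewrite fz => -[].
  have := min0 (V' 0) (ex_intro _ v (conj vw (fV' 0))).
  have := congr1 size (quotWV m); have := congr1 size (quotWV' m).
  rewrite !eqW eqV' -W0 -V0 !size_drop.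
  have := size_lcpl (W m) (V m); have := size_lcpl (W m) z.
  by have := size_lcpl (W 0) (V 0); have := size_lcpl (W 0) (V' 0); lia.
have W1 : W 1 = y by have := fW 1; rewrite addn1 fy => -[].
have := fhatE 0; have := fhatE 1; rewrite addn0 addn1 => -> ->.
by rewrite !bigL -W0 -W1 quotWV.
Qed.

Lemma aperiodic_canonical_bimachine : canonical_bimachine_aperiodic f.
Proof.
split; first by exists N0 => u; apply/aut_equiv_LeftfE => t; apply: simL_wpow.
by exists n => u; apply/aut_equiv_RfE => w; apply: (aut_equiv_lharp Tf); apply: stab.
Qed.

End Pumping.

(** The map [h] may be finer than [E]; sending [u] to the set of values of [h] on its class makes
    the fibres exactly the classes. Sets that arise from no class get the default representative
    [u0]. *)
Lemma finite_classes (U : Type) (E : U -> U -> Prop) (X : finType) (h : U -> X) (u0 : U) :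
    (forall u v, E u = E v <-> E u v) -> (forall u v, h u = h v -> E u v) ->
  exists (Y : finType) (cl : U -> Y) (rep : Y -> U),
    (forall u v, cl u = cl v <-> E u v) /\ (forall u, E (rep (cl u)) u).
Proof.
move=> E_eq hE; pose cl u := [set x | `[< exists v, E u v /\ h v = x >]].
have clE u v : cl u = cl v <-> E u v.
  split=> [/setP/(_ (h u))|/E_eq eq_uv]; last by rewrite /cl eq_uv.
  rewrite !inE => eq_cl; have : `[< exists v', E u v' /\ h v' = h u >].
    by apply/asboolP; exists u; split=> //; apply/E_eq.
  rewrite eq_cl => /asboolP[v' [/E_eq Evv' /hE/E_eq Ev'u]].
  by apply/E_eq; rewrite Evv'.
have [rep repP] : {rep : {set X} -> U & forall x, (exists u, cl u = x) -> cl (rep x) = x}.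
  apply: (choice (P := fun x v => (exists u, cl u = x) -> cl v = x)) => x.
  by have [[u <-]|none] := EM (exists u, cl u = x); [exists u | exists u0].
by exists {set X}, cl, rep; split=> // u; apply/clE/repP; exists u.
Qed.

(** * A transducer simulating the canonical bimachine, and its aperiodicity *)

Section BimachineTransducer.
Variables (Σ : finType) (Γ : eqType) (f : seq Σ -> option (seq Γ)).
Variables (L R : finType) (clL : seq Σ -> L) (clR : seq Σ -> R).
Variables (repL : L -> seq Σ) (repR : R -> seq Σ).
Hypothesis clL_E : forall u v, clL u = clL v <-> simL f u v.
Hypothesis clR_E : forall u v, clR u = clR v <-> lharp f u v.
Hypothesis repLK : forall u, simL f (repL (clL u)) u.
Hypothesis repRK : forall u, lharp f (repR (clR u)) u.

(* The right component of a state guesses the class of the remaining input. *)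
Definition bimachine_transducer : transducer Σ Γ :=
  @Transducer Σ Γ (L * R)%type
    (fun p a q => `[< exists s t, [/\ p.1 = clL s, q.1 = clL (rcons s a),
                                      p.2 = clR (a :: t) & q.2 = clR t] >])
    (fun p a q => lquot (fhat f (a :: repR q.2) (repL p.1))
                        (fhat f (repR q.2) (rcons (repL p.1) a)))
    (fun p => if p.1 == clL [::] then Some (fhat f (repR p.2) [::]) else None)
    (fun p => if p.2 == clR [::] then
                omap (lquot (fhat f [::] (repL p.1))) (f (repL p.1)) else None).
Local Notation B := bimachine_transducer.

Lemma bimachine_deltaP (p q : tQ B) a : tdelta p a q <->
  exists s t, [/\ p.1 = clL s, q.1 = clL (rcons s a), p.2 = clR (a :: t) & q.2 = clR t].
Proof. by split=> /asboolP. Qed.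

(** The final output is well defined on left classes, by [simL] with the empty continuation. *)
Lemma final_outputE u :
  omap (lquot (fhat f [::] (repL (clL u)))) (f (repL (clL u))) =
  omap (lquot (fhat f [::] u)) (f u).
Proof.
have [domE quotE] := repLK u [::]; rewrite !cats0 in domE quotE.
case fr : (f (repL (clL u))) => [y|]; case fu : (f u) => [z|] //=.
- by rewrite (quotE _ _ fr fu).
- by have /domE : indom f (repL (clL u)) by rewrite /indom fr.
- by have /domE : indom f u by rewrite /indom fu.
Qed.

(** Left classes propagate forwards and guessed right classes are checked backwards, while the
    transition outputs telescope. The domain condition is there because [fhat_rcons] gives the
    required prefix only on the domain. *)
Lemma trun_bimachine p u q x s t : trun B p u q x ->
    p.1 = clL s -> q.2 = clR t ->
  [/\ q.1 = clL (s ++ u), p.2 = clR (u ++ t) &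
      indom f (s ++ u ++ t) -> fhat f (u ++ t) s ++ x = fhat f t (s ++ u)].
Proof.
move=> run; elim: run s => {p u q x} [p s|p a r u q x].
  by move=> ? ?; rewrite !cats0; split.
move=> /bimachine_deltaP[s' [t' [p1 r1 p2 r2]]] _ IHu s eq_p1 eq_q2.
have ss' : simL f s' s by apply/clL_E; rewrite -p1.
have [|q1 r2' outE] := IHu (rcons s a) _ eq_q2.
  by rewrite r1; apply/clL_E/simL_rcons.
have tt' : lharp f t' (u ++ t) by apply/clR_E; rewrite -r2.
split; [by rewrite q1 cat_rcons | by rewrite p2; apply/clR_E/(lharp_catl [:: a]) |].
move=> du; rewrite /= r2' eq_p1 (simL_lquot_fhat _ _ (repLK s)).
rewrite (fhat_eq _ (lharp_catl [:: a] (repRK _))) (fhat_eq _ (repRK _)).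
rewrite catA cat_lquot; last by rewrite fhat_rcons // prefix_prefix.
by rewrite outE cat_rcons.
Qed.

Lemma trun_bimachine_ex u s t :
  exists x, trun B (clL s, clR (u ++ t)) u (clL (s ++ u), clR t) x.
Proof.
elim: u s => [|a u IHu] s; first by exists [::]; rewrite cats0; apply: trun_nil.
have [x run] := IHu (rcons s a); rewrite cat_rcons in run.
eexists; apply: trun_cons run; apply/bimachine_deltaP.
by exists s, (u ++ t).
Qed.

Lemma realizes_bimachine : realizes B f.
Proof.
move=> u y; split=> [fu|[p [q [i [o [x [ini_p [fin_q [run ->]]]]]]]]].
  have [x run] := trun_bimachine_ex u [::] [::].
  exists (clL [::], clR (u ++ [::])), (clL u, clR [::]).
  exists (fhat f u [::]), (lquot (fhat f [::] u) y), x; do !split=> //=.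
  - by rewrite eqxx (fhat_eq _ (repRK _)) cats0.
  - by rewrite eqxx final_outputE fu.
  have [//|//|_ _] := trun_bimachine run (s := [::]) (t := [::]).
  rewrite /= cats0 => outE; rewrite catA outE ?/indom ?fu //.
  by rewrite cat_lquot //; apply: fhat_prefix; rewrite cats0.
move: ini_p fin_q => /=; case: eqP => // p1 [<-]; case: eqP => // q2.
have [q1 p2 outE] := trun_bimachine run p1 q2; rewrite /= cats0 in q1 p2 outE.
rewrite q1 p2 final_outputE (fhat_eq _ (repRK _)).
case fu : (f u) => [z|] //= [<-].
by rewrite catA outE ?/indom ?fu // cat_lquot //; apply: fhat_prefix; rewrite cats0.
Qed.

(** The maps [clL] and [clR] are not assumed onto, so a state may have components that are no
    classes. The first transition of a nonempty run certifies [p.1], and the last one [q.2]. *)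
Lemma trun_bimachine_classes p u q x : trun B p u q x ->
  u = [::] \/ exists s t, p.1 = clL s /\ q.2 = clR t.
Proof.
elim=> {p u q x} [p|p a r u q x /bimachine_deltaP[s [t [p1 _ _ r2]]] run]; first by left.
move=> [u0|[_ [t' [_ q2]]]]; right; last by exists s, t'.
by move: run; rewrite u0 => /trun_nilE[<- _]; exists s, t.
Qed.

(** A nonempty run is determined by the left class at its start and the right class at its end, on
    which [u] and [v] act alike. The empty word is set apart because it also has runs at states that
    carry no classes. *)
Lemma aut_equiv_bimachine u v : u <> [::] -> v <> [::] ->
    aut_equiv (Leftf f) u v -> aut_equiv (Rf f) u v ->
  aut_equiv (underlying B) u v.
Proof.
suff sub u' v' : u' <> [::] -> aut_equiv (Leftf f) u' v' -> aut_equiv (Rf f) u' v' ->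
    forall p q, reach (underlying B) p u' q -> reach (underlying B) p v' q.
  move=> u0 v0 eqL eqR p q.
  by split; apply: sub => //; apply: aut_equiv_sym.
move=> u0 /aut_equiv_LeftfE eqL /aut_equiv_RfE eqR [p1 p2] [q1 q2].
move=> /reach_underlyingE[x run]; apply/reach_underlyingE.
have [//|[s [t [eq_p eq_q]]]] := trun_bimachine_classes run.
have [/= eq_q1 eq_p2 _] := trun_bimachine run eq_p eq_q.
have [y run'] := trun_bimachine_ex v' s t; exists y.
rewrite /= in eq_p eq_q; rewrite eq_p eq_q eq_q1 eq_p2.
by rewrite (proj2 (clL_E _ _) (eqL s)) (proj2 (clR_E _ _) (eqR t)).
Qed.

Lemma ap_rational_bimachine : canonical_bimachine_aperiodic f -> ap_rational f.
Proof.
case=> /aperiodic_autP[m m_gt0 stabL] /aperiodic_autP[n n_gt0 stabR].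
exists B; split; first exact: realizes_bimachine.
(* This exponent passes both thresholds and is positive, so the powers of a nonempty word are
   nonempty. *)
exists (m + n) => -[|a w]; first by rewrite !wpow_nil; apply: aut_equiv_refl.
apply: aut_equiv_bimachine; last by apply: stabR; lia.
- by case: (m + n) (addn_gt0 m n) => //; rewrite m_gt0.
- by [].
by apply: stabL; lia.
Qed.

End BimachineTransducer.

Theorem theorem5p4 (Σ Γ : finType) (f : seq Σ -> option (seq Γ)) :
  rational f -> (ap_rational f <-> canonical_bimachine_aperiodic f).
Proof.
move=> [T Tf]; split=> [[T' [T'f /aperiodic_autP[n n_gt0 stab]]]|].
  exact: (aperiodic_canonical_bimachine T'f n_gt0 stab).
(* Here [T] may fail to be aperiodic; it only provides the finiteness of both congruences, hence of
   the simulating transducer. *)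
have [X [h hP]] := lharp_finite Tf; have [Y [g gP]] := simL_finite Tf.
have [R [clR [repR [clR_E repRK]]]] := finite_classes [::] (@lharp_eqE _ _ f) hP.
have [L [clL [repL [clL_E repLK]]]] := finite_classes [::] (@simL_eqE _ _ f) gP.
exact: ap_rational_bimachine clL_E clR_E repLK repRK.
Qed.
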